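(* 1. Let $r>s\ge 1$ be fixed integers. Then there exists an integer $N$ such that $\lambda(G(n,r,s))=E_{r-s}(1)$ for all $n>N$, and $E_{r-s}(1)\sim\frac{s}{r}d(G(n,r,s))$ as $n\to\infty$. 2. Let $r=r(n)$, $s=s(n)$ satisfy $n\gg r(n)\gg s(n)$ and $r^2(n)\gg n$. Then $\lambda(G(n,r,s))=o(d(G(n,r,s)))$ as $n\to\infty$. 3. Let $r=r(n)$, $s=s(n)$ satisfy $r(n)=O(\sqrt n)$ and $r\gg s\ge 1$. Then $\lambda(G(n,r,s))=O\left(\frac{s}{r}d(G(n,r,s))\right)$ as $n\to\infty$. Moreover, if at least one of the conditions (a) $s=\omega(1)$; (b) $r=o(\sqrt n)$ holds, then $\lambda(G(n,r,s))=(1+o(1))\frac{s}{r}d(G(n,r,s))$.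
   Context: For integers $n,r,s$, the Johnson graph $G(n,r,s)$ has as vertices all vectors $v\in\{0,1\}^n$ with exactly $r$ ones; two vertices are joined by an edge if and only if their inner product equals $s$. It is regular; $d(G)$ denotes the vertex degree of a regular graph $G$, so $d(G(n,r,s))=\binom{r}{s}\binom{n-r}{r-s}$. For a $d$-regular graph $G$ whose adjacency matrix has eigenvalues (with multiplicity) $\lambda_1\ge\lambda_2\ge\dots\ge\lambda_m$, where $m$ is the number of vertices, $\lambda(G):=\max\{\lambda_2,-\lambda_m\}=\max\{|\lambda_2|,\dots,|\lambda_m|\}$. For given $n,r$ put $E_k(i)=\sum_{j=0}^{k}(-1)^j\binom{i}{j}\binom{r-i}{k-j}\binom{n-r-i}{k-j}$ for $0\le i\le r$, where a binomial coefficient $\binom{a}{b}$ with $b<0$ or $b>a$ equals $0$. $f(n)\gg g(n)$ means $f(n)/g(n)\to\infty$ as $n\to\infty$; $s=\omega(1)$ means $s(n)\to\infty$. All asymptotics are as $n\to\infty$. *)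

(* Defs.v *)
From mathcomp Require Import all_boot all_order all_algebra.

Set Implicit Arguments.
Unset Strict Implicit.
Unset Printing Implicit Defensive.

Import Order.TTheory GRing.Theory Num.Theory.

Local Open Scope ring_scope.

Definition degree (V : finType) (e : rel V) (x : V) : nat :=
  #|[set y | e x y]|.

(* The common degree of the vertices of a regular graph, read off an
   arbitrary vertex; 0 on the empty graph. *)
Definition regular_degree (V : finType) (e : rel V) : nat :=
  if [pick x : V] is Some x then degree e x else 0.

Definition adjacency_mx (R : pzSemiRingType) (V : finType) (e : rel V) :
    'M[R]_#|V| :=
  \matrix_(i, j) (e (enum_val i) (enum_val j))%:R.

Definition inner_prod (n : nat) (v w : {ffun 'I_n -> bool}) : nat :=
  (\sum_(i < n) v i * w i)%N.

Definition johnson_vertex (n r : nat) : finType :=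
  {v : {ffun 'I_n -> bool} | #|[set i | v i]| == r}.

(* Distinctness excludes loops; it is automatic when s < r. *)
Definition johnson (n r s : nat) : rel (johnson_vertex n r) :=
  [rel v w | (v != w) && (inner_prod (val v) (val w) == s)].
Arguments johnson : clear implicits.

Definition binz (a b : int) : nat :=
  if (0 <= b) && (b <= a) then 'C(`|a|, `|b|) else 0.

Definition Ek (n r k i : nat) : int :=
  \sum_(j < k.+1)
     (-1) ^+ j * (binz i j)%:Z * (binz (r%:Z - i%:Z) (k%:Z - j%:Z))%:Z
               * (binz (n%:Z - r%:Z - i%:Z) (k%:Z - j%:Z))%:Z.

Local Close Scope ring_scope.

Lemma card_draws_setIC (T : finType) (A : {set T}) (a b : nat) :
  #|[set B : {set T} | (#|A :&: B| == a) && (#|~: A :&: B| == b)]| =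
  'C(#|A|, a) * 'C(#|~: A|, b).
Proof.
rewrite -!cards_draws -cardsX.
rewrite -(@card_in_imset _ _ (fun B : {set T} => (A :&: B, ~: A :&: B))); last first.
  move=> B C _ _ [h1 h2].
  by rewrite -[B]setTI -[C]setTI -(setUCr A) !setIUl h1 h2.
apply: eq_card => -[X Y]; rewrite !inE /=; apply/imsetP/idP.
  case=> B; rewrite inE => /andP[? ?] [-> ->]; by rewrite !subsetIl /=; apply/andP.
case/andP=> /andP[sX cX] /andP[sY cY].
have e1 : A :&: (X :|: Y) = X.
  rewrite setIUr (setIidPr sX); apply/setUidPl/subsetP=> x; rewrite inE => /andP[xA xY].
  by have := subsetP sY x xY; rewrite inE xA.
have e2 : ~: A :&: (X :|: Y) = Y.
  rewrite setIUr (setIidPr sY); apply/setUidPr/subsetP=> x; rewrite inE => /andP[xA xY].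
  by rewrite inE (subsetP sX x xY) in xA.
by exists (X :|: Y); rewrite ?inE e1 e2 ?cX ?cY.
Qed.

Lemma johnson_degree (n r s : nat) (v : johnson_vertex n r) :
  s < r -> degree (johnson n r s) v = 'C(r, s) * 'C(n - r, r - s).
Proof.
move=> sr.
pose S (w : {ffun 'I_n -> bool}) := [set i | w i].
have inE' w w' : inner_prod w w' = #|S w :&: S w'|.
  rewrite /inner_prod -sum1_card [RHS]big_mkcond; apply: eq_bigr => i _.
  by rewrite !inE; case: (w i); case: (w' i).
have cv : #|S (val v)| = r by apply/eqP; exact: (valP v).
have -> : n - r = #|~: S (val v)| by rewrite cardsCs setCK card_ord cv.
rewrite -[r in 'C(r, s)]cv -card_draws_setIC /degree.
have injS : injective (fun w : johnson_vertex n r => S (val w)).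
  move=> w w' /setP h; apply/val_inj/ffunP => i; by have := h i; rewrite !inE.
rewrite -(card_imset _ injS); apply: eq_card => B; rewrite inE; apply/imsetP/idP.
  case=> w; rewrite inE /johnson /= => /andP[_ /eqP]; rewrite inE' => h ->.
  have := cardsID (S (val v)) (S (val w)); rewrite (eqP (valP w)).
  rewrite setIC setDE (setIC (S (val w)) (~: _)) => e.
  move: h e; rewrite /= => h e; rewrite h eqxx /= -[in X in _ == X]e.
  by rewrite -h addKn.
case/andP=> /eqP h1 /eqP h2.
have cB : #|[set i | [ffun i => i \in B] i]| == r.
  have -> : [set i | [ffun i => i \in B] i] = B by apply/setP=> i; rewrite inE ffunE.
  by rewrite -(cardsID (S (val v))) setIC h1 setDE setIC h2 subnKC // ltnW.
have SB : S [ffun i => i \in B] = B by apply/setP=> i; rewrite inE ffunE.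
exists (exist _ [ffun i => i \in B] cB); last by rewrite /= SB.
rewrite inE /johnson /= inE' SB h1 eqxx andbT.
apply/eqP=> e.
have cB' : #|B| = r by rewrite -SB; exact/eqP.
by move: h1; rewrite e /= SB setIid cB' => e'; rewrite e' ltnn in sr.
Qed.

From mathcomp Require Import all_classical all_reals all_analysis.
From mathcomp Require complex.

Import numFieldNormedType.Exports.

Local Open Scope classical_set_scope.
Local Open Scope ring_scope.

(* The eigenvalues with multiplicity, in nonincreasing order. They exist
   whenever A is symmetric, see symmetric_spectrum. *)
Definition spectrum (R : realType) (m : nat) (A : 'M[R]_m) : seq R :=
  xget [::] [set s : seq R | sorted >=%R s /\
                             char_poly A = \prod_(x <- s) ('X - x%:P)].

(* Indices start at 0, so s`_1 is lambda_2 and s`_(size s).-1 is lambda_m. *)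
Definition graph_lambda (R : realType) (V : finType) (e : rel V) : R :=
  let s := spectrum (adjacency_mx R e) in
  Num.max s`_1 (- s`_(size s).-1).

(* f >> g. In \bar R, x / 0 is +oo for x > 0, so g may vanish. *)
Definition dominates (R : realType) (f g : nat -> nat) : Prop :=
  ((f n)%:R%:E / (g n)%:R%:E)%E @[n --> \oo] --> (+oo%E : \bar R).

Section SymmetricSpectrum.
Import complex.
Local Open Scope complex_scope.

Lemma symmetric_spectrum (R : realType) (m : nat) (A : 'M[R]_m) :
  A^T = A ->
  sorted >=%R (spectrum A) /\
  char_poly A = \prod_(x <- spectrum A) ('X - x%:P).
Proof.
move=> sA; rewrite /spectrum.
suff [s0 Hs0] : exists s : seq R, char_poly A = \prod_(x <- s) ('X - x%:P).
  apply: (@xgetPex _ [::] [set s : seq R | sorted >=%R s /\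
     char_poly A = \prod_(x <- s) ('X - x%:P)]).
  exists (sort >=%R s0); split; first by apply: sort_sorted => x y; exact: le_total.
  by rewrite Hs0; apply: perm_big; rewrite perm_sym perm_sort.
pose f := real_complex R.
pose B := map_mx f A.
have hB : B \is hermsymmx.
  apply: realsym_hermsym.
    apply/is_hermitianmxP; rewrite expr0 scale1r map_mx_id //.
    by rewrite map_trmx sA.
  by apply/mxOverP => i j; rewrite mxE complex_real.
have /orthomx_spectralP BE := hermitian_normalmx hB.
have /mxOverP rD := hermitian_spectral_diag_real hB.
have cpB : char_poly B = \prod_(j < m) ('X - (spectral_diag B 0 j)%:P).
  have U := spectral_unit B.
  have -> : char_poly B = char_poly (diag_mx (spectral_diag B)).
    rewrite {1}BE /char_poly; set P := spectralmx B in U *.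
    set D := diag_mx _.
    have PV : map_mx polyC (invmx P) *m map_mx polyC P = 1%:M.
      by rewrite -map_mxM mulVmx // map_mx1.
    have -> : char_poly_mx (invmx P *m D *m P) =
        map_mx polyC (invmx P) *m char_poly_mx D *m map_mx polyC P.
      rewrite /char_poly_mx mulmxBr mulmxBl !map_mxM; congr (_ - _).
      by rewrite scalar_mxC -mulmxA PV mulmx1.
    by rewrite !det_mulmx mulrAC -det_mulmx PV det1 mul1r.
  rewrite char_poly_trig ?diag_mx_is_trig //.
  by apply: eq_bigr => j _; rewrite mxE eqxx mulr1n.
exists [seq complex.Re (spectral_diag B 0 j) | j <- index_enum 'I_m].
apply: (map_poly_inj f); rewrite map_char_poly -/B cpB big_map rmorph_prod.
apply: eq_bigr => j _; rewrite rmorphB /= map_polyX map_polyC /=.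
by congr (_ - _%:P); rewrite -[LHS]RRe_real.
Qed.

End SymmetricSpectrum.

(* Main.v *)
Require Import Defs.
From mathcomp Require Import all_boot all_order all_algebra.
From mathcomp Require Import all_classical all_reals all_analysis.
From mathcomp Require Import perm zify ring lra.
Import Order.TTheory GRing.Theory Num.Theory numFieldNormedType.Exports.
Local Open Scope ring_scope.

(* Let d be the degree of G(n,r,s) and f an eigenfunction for mu orthogonal to
   the constants. The symmetric group acts transitively on the vertices, so
   some transposition (a b) moves f, and g = f - f o (a b) is an eigenfunction
   for mu which is antisymmetric under (a b), hence supported on the vertices
   containing exactly one of a and b. Evaluating the eigenvalue equation at a
   vertex x where |g| is maximal bounds |mu| by the number of such neighbours
   of x, which is at most (s/r + (r-s)/(n-r)) d. On the other hand the
   difference of two coordinate functions is an eigenfunction for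
   (s/r - (r-s)/(n-r)) d = E_{r-s}(1). Thus lambda differs from (s/r) d by at
   most d (r-s)/(n-r), which gives all the asymptotics. For the exact value,
   either g is a multiple of a difference of coordinates, or g can be
   antisymmetrized under a second, disjoint transposition, and then |mu| is at
   most (s(s-1)/(r(r-1)) + 2(r-s)/(n-r)) d, less than E_{r-s}(1) for large n. *)

(** * The spectrum of a regular graph *)

Lemma char_poly_similar (F : fieldType) (m : nat) (P Q A : 'M[F]_m) :
  P *m Q = 1%:M -> char_poly (P *m A *m Q) = char_poly A.
Proof.
move=> PQ; have PQp : map_mx polyC P *m map_mx polyC Q = 1%:M.
  by rewrite -map_mxM PQ map_mx1.
rewrite /char_poly.
have -> : char_poly_mx (P *m A *m Q) =
    map_mx polyC P *m char_poly_mx A *m map_mx polyC Q.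
  rewrite /char_poly_mx mulmxBr mulmxBl !map_mxM; congr (_ - _).
  by rewrite scalar_mxC -mulmxA PQp mulmx1.
by rewrite !det_mulmx mulrAC -det_mulmx PQp det1 mul1r.
Qed.

Lemma char_poly_ublock (F : fieldType) (m p : nat) (A : 'M[F]_m)
    (B : 'M[F]_(m, p)) (D : 'M[F]_p) :
  char_poly (block_mx A B 0 D) = char_poly A * char_poly D.
Proof.
rewrite /char_poly -(det_ublock _ (- map_mx polyC B)); congr (\det _).
rewrite /char_poly_mx map_block_mx map_mx0 scalar_mx_block opp_block_mx.
by rewrite add_block_mx oppr0 addr0 add0r; congr block_mx.
Qed.

(* Conjugation by a matrix whose first column is the constant vector 1 makes
   A block triangular with diagonal blocks d and D; the rows of D are the action of A
   on the row vectors orthogonal to 1. *)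
Lemma deflation (F : fieldType) (m : nat) (A : 'M[F]_(1 + m)) (d : F) :
  A *m const_mx 1 = d *: (const_mx 1 : 'cV[F]_(1 + m)) ->
  exists2 D : 'M[F]_m, char_poly A = ('X - d%:P) * char_poly D &
    forall mu, eigenvalue D mu <->
      exists f : 'rV[F]_(1 + m),
        [/\ f != 0, f *m A = mu *: f & f *m const_mx 1 = (0 : 'M[F]_1)].
Proof.
move=> A1.
pose T : 'M[F]_(1 + m) := block_mx 1%:M 0 (const_mx 1) 1%:M.
pose U : 'M[F]_(1 + m) := block_mx 1%:M 0 (- const_mx 1) 1%:M.
have UT : U *m T = 1%:M.
  rewrite /U /T mulmx_block !mul1mx !mulmx1 !mul0mx !mulmx0 !addr0 add0r addNr.
  by rewrite -scalar_mx_block.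
have TU : T *m U = 1%:M by apply: mulmx1C.
have c1 : (const_mx 1 : 'cV[F]_(1 + m)) = col_mx 1%:M (const_mx 1).
  by rewrite -[const_mx 1]vsubmxK; congr col_mx; apply/matrixP=> i j; rewrite !mxE ?ord1 ?eqxx.
have T1 : (const_mx 1 : 'cV[F]_(1 + m)) = T *m col_mx 1%:M 0.
  by rewrite /T mul_block_col !mulmx0 !addr0 !mulmx1 c1.
pose M := U *m A *m T.
have M1 : M *m col_mx 1%:M 0 = d *: (col_mx 1%:M 0 : 'cV[F]_(1 + m)).
  by rewrite /M -!mulmxA -T1 A1 -scalemxAr T1 mulmxA UT mul1mx.
have [c [D ME]] : exists c D, M = block_mx d%:M c 0 D.
  exists (ursubmx M), (drsubmx M).
  have := M1; rewrite -{1}[M]submxK mul_block_col !mulmx0 !addr0 !mulmx1.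
  rewrite scale_col_mx scaler0 => /eq_col_mx[e1 e2].
  by rewrite -{1}[M]submxK e1 e2 scalemx1.
have AE : A = T *m M *m U by rewrite /M !mulmxA TU mul1mx -mulmxA TU mulmx1.
clearbody M; clear M1.
exists D.
  rewrite AE char_poly_similar // ME char_poly_ublock; congr (_ * _).
  by rewrite char_poly_trig ?big_ord1 ?mxE ?eqxx ?mulr1n // is_diag_mx_is_trig // mx11_is_diag.
(* The first column of [T] is constant 1, so the first entry of [f *m T] is the sum of [f]. Vectors
   orthogonal to the constants thus become those supported on the last [m] coordinates, where [M]
   acts as [D]. *)
have fT (f : 'rV[F]_(1 + m)) : lsubmx (f *m T) = f *m const_mx 1.
  rewrite T1 mulmxA -[f *m T in RHS]hsubmxK mul_row_col mulmx0 addr0 mulmx1.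
  by [].
move=> mu; split.
  case/eigenvalueP=> w wA w0; exists (row_mx 0 w *m U); split.
  - apply: contra_neq w0 => /(congr1 (mulmx^~ T)).
    rewrite mul0mx -mulmxA UT mulmx1 => /(congr1 rsubmx).
    by rewrite row_mxKr linear0.
  - have wM : row_mx 0 w *m M = mu *: (row_mx 0 w : 'rV_(1 + m)).
      by rewrite ME mul_row_block !mul0mx mulmx0 !add0r wA scale_row_mx scaler0.
    by rewrite AE -(mulmxA _ M) mulmxA -(mulmxA _ U) UT mulmx1 mulmxA wM -scalemxAl.
  - by rewrite -fT -mulmxA UT mulmx1 row_mxKl.
case=> f [f0 fA f1]; apply/eigenvalueP; exists (rsubmx (f *m T)).
  have fM : f *m T *m M = mu *: (f *m T).
    by rewrite scalemxAl -fA AE -!mulmxA UT mulmx1.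
  have gE : f *m T = row_mx 0 (rsubmx (f *m T)) by rewrite -f1 -fT hsubmxK.
  move: fM; rewrite gE ME mul_row_block !mul0mx mulmx0 !add0r scale_row_mx.
  by move=> /eq_row_mx[_]; rewrite row_mxKr.
apply: contra_neq f0 => r0.
have fT0 : f *m T = 0 by rewrite -[f *m T]hsubmxK fT f1 r0 row_mx0.
by rewrite -[f]mulmx1 -TU mulmxA fT0 mul0mx.
Qed.

(** Cancelling ['X - d%:P] from both factorizations of the characteristic polynomial removes exactly
    one copy of [d]. Further copies stay in [t], so connectedness is not at issue. *)
Lemma spectrum_deflation (R : realType) (m : nat) (A : 'M[R]_m) (d : R) :
  (0 < m)%N -> A^T = A -> A *m const_mx 1 = d *: (const_mx 1 : 'cV[R]_m) ->
  exists2 t : seq R, perm_eq (spectrum A) (d :: t) &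
    forall mu, mu \in t <->
      exists f : 'rV[R]_m,
        [/\ f != 0, f *m A = mu *: f & f *m const_mx 1 = (0 : 'M[R]_1)].
Proof.
case: m A => // m A _ sA A1.
have [_ cA] := symmetric_spectrum sA.
have [D cD eD] := deflation _ _ _ _ A1.
set s := spectrum A in cA *.
have ds : d \in s.
  by rewrite -root_prod_XsubC -cA cD rootM root_XsubC eqxx.
have cDs : char_poly D = \prod_(x <- rem d s) ('X - x%:P).
  apply: (@mulfI _ ('X - d%:P)); first by rewrite polyXsubC_eq0.
  by rewrite -cD cA (perm_big _ (perm_to_rem ds)) big_cons.
exists (rem d s); first exact: perm_to_rem.
by move=> mu; rewrite -eD eigenvalue_root_char cDs root_prod_XsubC.
Qed.

(** * Eigenfunctions of a regular graph and lambda *)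

Section GraphSpectrum.
Variables (R : realType) (V : finType) (e : rel V) (d : nat).
Hypotheses (e_sym : symmetric e) (e_reg : forall x, degree e x = d).

Definition eigenfunction (mu : R) (f : V -> R) : Prop :=
  forall x, \sum_(y | e x y) f y = mu * f x.

Lemma sum_enum_val (F : V -> R) :
  \sum_(i < #|V|) F (enum_val i) = \sum_x F x.
Proof. by rewrite (reindex (enum_val : 'I_#|V| -> V)) //; apply: onW_bij; exact: enum_val_bij. Qed.

Lemma adjacency_mx_sym : (adjacency_mx R e)^T = adjacency_mx R e.
Proof. by apply/matrixP => i j; rewrite !mxE e_sym. Qed.

Lemma adjacency_spectrum : (0 < #|V|)%N ->
  exists2 t : seq R, perm_eq (spectrum (adjacency_mx R e)) (d%:R :: t) &
    forall mu, mu \in t <->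
      exists f : V -> R,
        [/\ exists x, f x != 0, eigenfunction mu f & \sum_x f x = 0].
Proof.
move=> V0; set A := adjacency_mx R e.
have sA : A^T = A := adjacency_mx_sym.
have sumE (f : 'rV[R]_#|V|) x : (f *m A) 0 (enum_rank x) =
    \sum_(y | e x y) f 0 (enum_rank y).
  rewrite mxE [RHS]big_mkcond -[RHS]sum_enum_val; apply: eq_bigr => i _.
  rewrite mxE enum_valK enum_rankK e_sym.
  by case: (e x _); rewrite ?mulr1 ?mulr0.
have A1 : A *m const_mx 1 = d%:R *: (const_mx 1 : 'cV[R]_#|V|).
  rewrite -[LHS]trmxK trmx_mul sA trmx_const; apply/matrixP => i j.
  rewrite mxE -[i]enum_valK ord1 sumE !mxE mulr1.
  rewrite -(e_reg (enum_val i)) /degree -sum1_card natr_sum.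
  by apply: eq_big => y; rewrite ?inE // !mxE.
have [t pt tE] := @spectrum_deflation R _ A d%:R V0 sA A1.
exists t => // mu; rewrite tE.
have sum1E (f : 'rV[R]_#|V|) : (f *m (const_mx 1 : 'cV[R]_#|V|)) 0 0 = \sum_x f 0 (enum_rank x).
  rewrite mxE -sum_enum_val; apply: eq_bigr => i _.
  by rewrite mxE mulr1 enum_valK.
split=> -[f [f0 fA f1]].
  exists (fun x => f 0 (enum_rank x)); split.
  - case: (pselect (exists i, f 0 i != 0)) => [[i fi]|nf].
      by exists (enum_val i); rewrite enum_valK.
    case/negP: f0; apply/eqP/rowP => i; rewrite mxE; apply/eqP.
    by apply/negPn/negP => fi; apply: nf; exists i.
  - by move=> x; rewrite -sumE fA mxE.
  - by rewrite -sum1E f1 mxE.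
exists (\row_i f (enum_val i)); split.
- case: f0 => x fx; apply: contra_neq fx => /rowP/(_ (enum_rank x)).
  by rewrite !mxE enum_rankK.
- apply/rowP => i; rewrite -[i]enum_valK sumE !mxE enum_rankK -fA.
  by apply: eq_bigr => y _; rewrite mxE enum_rankK.
- apply/matrixP => i j; rewrite !ord1 sum1E mxE -[RHS]f1.
  by apply: eq_bigr => y _; rewrite mxE enum_rankK.
Qed.

(** Only the removed copy of [d] can exceed [B], so the second largest eigenvalue cannot. The last
    one is either in [t] or equal to [d], and then its negative is at most 0. *)
Lemma graph_lambda_le (B : R) : (0 < #|V|)%N -> 0 <= B ->
  (forall mu (f : V -> R), (exists x, f x != 0) -> eigenfunction mu f ->
     \sum_x f x = 0 -> `|mu| <= B) ->
  graph_lambda R e <= B.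
Proof.
move=> V0 B0 HB; have [t pt tE] := adjacency_spectrum V0.
have tB mu : mu \in t -> `|mu| <= B by move=> /tE[f [? ? ?]]; exact: (HB mu f).
rewrite /graph_lambda; set s := spectrum _ in pt *.
have srt : sorted >=%R s := (symmetric_spectrum adjacency_mx_sym).1.
have s0 : (0 < size s)%N by rewrite (perm_size pt).
rewrite ge_max; apply/andP; split.
  rewrite leNgt; apply/negP => sB.
  have tcount : count (> B) t = 0%N.
    apply/eqP; rewrite -leqn0 leqNgt -has_count; apply/hasPn => x /tB xB /=.
    by rewrite -leNgt (le_trans _ xB) // ler_norm.
  have : (count (> B) s <= 1)%N by rewrite (seq.permP pt) /= tcount addn0 leq_b1.
  (* With fewer than two eigenvalues the entry of index 1 is the default 0, which is at most [B]. *)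
  move: srt sB; case: (s) => [|x [|y u]] /=.
  - by rewrite ltNge B0.
  - by rewrite ltNge B0.
  - by case/andP=> yx _ yB; rewrite yB (lt_le_trans yB yx).
have : s`_(size s).-1 \in d%:R :: t by rewrite -(perm_mem pt) mem_nth // prednK.
rewrite inE => /orP[/eqP ->|/tB xB].
  by rewrite (le_trans _ B0) // oppr_le0 ler0n.
by rewrite (le_trans _ xB) // -normrN ler_norm.
Qed.

(** Both [d] and the copy of [mu] in [t] are at least [mu], so the sorted spectrum has two entries
    at least [mu], and the second one is among them. *)
Lemma graph_lambda_ge (mu : R) (f : V -> R) :
  (exists x, f x != 0) -> eigenfunction mu f -> \sum_x f x = 0 ->
  mu <= d%:R -> mu <= graph_lambda R e.
Proof.
move=> f0 fmu f1 mud.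
have V0 : (0 < #|V|)%N by case: f0 => x _; apply/card_gt0P; exists x.
have [t pt tE] := adjacency_spectrum V0.
have mut : mu \in t by apply/tE; exists f.
rewrite /graph_lambda; set s := spectrum _ in pt *.
have srt : sorted >=%R s := (symmetric_spectrum adjacency_mx_sym).1.
have t1 : (0 < count (>= mu) t)%N by rewrite -has_count; apply/hasP; exists mu.
have : (1 < count (>= mu) s)%N by rewrite (seq.permP pt) /= mud.
rewrite le_max; move: srt; case: (s) => [|x [|y u]] //=; first by case: (_ <= _).
case/andP=> _ srt c2; apply/orP; left; rewrite leNgt; apply/negP => ymu.
have : (count (>= mu) u = 0)%N.
  apply/eqP; rewrite -leqn0 leqNgt -has_count; apply/hasPn => z zu /=.
  rewrite -ltNge (le_lt_trans _ ymu) //.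
  have tr : transitive (>=%R : rel R) by move=> a b c ab bc; exact: le_trans bc ab.
  by have /allP/(_ z zu) := order_path_min tr srt.
by move: c2 => /[swap] ->; rewrite (leNgt mu y) ymu /=; case: (_ <= _).
Qed.

End GraphSpectrum.

(** * Counting neighbours in Johnson graphs *)

Section Johnson.
Variables (n r : nat).
Notation V := (johnson_vertex n r).
Implicit Types (x y : V) (a b c : 'I_n).

Definition ones x : {set 'I_n} := [set i | val x i].

Lemma card_ones x : #|ones x| = r.
Proof. exact/eqP/(valP x). Qed.

Lemma ones_inj : injective ones.
Proof.
by move=> x y /setP h; apply/val_inj/ffunP => i; have := h i; rewrite !inE.
Qed.

Lemma inner_prodE x y : inner_prod (val x) (val y) = #|ones x :&: ones y|.
Proof.
rewrite /inner_prod -sum1_card [RHS]big_mkcond; apply: eq_bigr => i _.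
by rewrite !inE; case: (val x i); case: (val y i).
Qed.

Lemma vertex_of_subproof (A : {set 'I_n}) : #|A| = r ->
  #|[set i | [ffun i => i \in A] i]| == r.
Proof.
by move=> <-; apply/eqP; apply: eq_card => i; rewrite inE ffunE.
Qed.

Lemma ones_surj (A : {set 'I_n}) : #|A| = r -> exists x, ones x = A.
Proof.
move=> cA; exists (exist _ [ffun i => i \in A] (vertex_of_subproof A cA)).
by apply/setP => i; rewrite inE /= ffunE.
Qed.

Lemma swap_subproof a b x :
  #|[set i | [ffun i => val x (tperm a b i)] i]| == r.
Proof.
apply/eqP; rewrite -[RHS](card_ones x).
rewrite -[RHS](card_preimset (f := tperm a b)); last exact: perm_inj.
by apply: eq_card => i; rewrite !inE ffunE.
Qed.

Definition swap a b x : V :=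
  exist _ [ffun i => val x (tperm a b i)] (swap_subproof a b x).

Lemma swapE a b x i : val (swap a b x) i = val x (tperm a b i).
Proof. by rewrite /= ffunE. Qed.

Lemma swapK a b : involutive (swap a b).
Proof.
move=> x; apply/val_inj/ffunP => i.
by change (val (swap a b (swap a b x)) i = val x i); rewrite !swapE tpermK.
Qed.

Lemma swapC a b : swap a b =1 swap b a.
Proof.
move=> x; apply/val_inj/ffunP => i.
by change (val (swap a b x) i = val (swap b a x) i); rewrite !swapE tpermC.
Qed.

Lemma swap_id a b x : val x a = val x b -> swap a b x = x.
Proof.
move=> xab; apply/val_inj/ffunP => i.
change (val (swap a b x) i = val x i); rewrite swapE.
by case: tpermP => [->|->|].
Qed.

Lemma swap_comm a b c e x :
  a != c -> a != e -> b != c -> b != e ->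
  swap a b (swap c e x) = swap c e (swap a b x).
Proof.
move=> ac ae bc be; apply/val_inj/ffunP => i.
change (val (swap a b (swap c e x)) i = val (swap c e (swap a b x)) i).
rewrite !swapE; congr (val x _).
case: (tpermP a b i) => [->|->|/eqP ia /eqP ib].
- by rewrite (@tpermD _ c e b) 1?eq_sym // (@tpermD _ c e a) 1?eq_sym // tpermL.
- by rewrite (@tpermD _ c e b) 1?eq_sym // (@tpermD _ c e a) 1?eq_sym // tpermR.
- by case: (tpermP c e i) => [_|_|_ _]; rewrite tpermD // eq_sym.
Qed.

Lemma inner_prod_swap a b x y :
  inner_prod (val (swap a b x)) (val (swap a b y)) =
  inner_prod (val x) (val y).
Proof.
rewrite /inner_prod [RHS](reindex_inj (@perm_inj _ (tperm a b))).
by apply: eq_bigr => i _; rewrite !swapE.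
Qed.

(* Swaps inside D act transitively on the vertices with a given restriction to
   the complement of D: each swap decreases |x \ y|. *)
Lemma swap_invariant (T : Type) (D : {set 'I_n}) (f : V -> T) :
  (forall a b x, a \in D -> b \in D -> f (swap a b x) = f x) ->
  forall x y, (forall i, i \notin D -> val x i = val y i) -> f x = f y.
Proof.
move=> fD x y; move: {2}#|_| (leqnn #|ones x :\: ones y|) => m.
elim: m x => [|m IH] x.
  rewrite leqn0 cards_eq0 finset.setD_eq0 => sxy _; congr f; apply: ones_inj.
  by apply/eqP; rewrite eqEcard sxy !card_ones leqnn.
move=> cxy xy; have [sxy|] := boolP (ones x \subset ones y).
  by apply: IH => //; move: sxy; rewrite -finset.setD_eq0 -cards_eq0 => /eqP ->.
case/subsetPn => a; rewrite !inE => xa ya.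
(* Since x and y have equally many ones, a point [a] of x outside y comes with a point [b] of y
   outside x. Both lie in [D], as x and y agree elsewhere. *)
have [sxy|] := boolP (ones y \subset ones x).
  have yx : ones y = ones x by apply/eqP; rewrite eqEcard sxy !card_ones leqnn.
  by move/setP/(_ a): yx; rewrite !inE xa (negPf ya).
case/subsetPn => b; rewrite !inE => yb xb.
have aD : a \in D by apply: contraNT ya => /xy <-.
have bD : b \in D by apply: contraNT xb => /xy ->.
have ab : a != b by apply: contraNneq xb => <-.
rewrite -(fD a b x aD bD); apply: IH => [|i iD]; last first.
  rewrite swapE tpermD ?xy //; first by apply: contraNneq iD => <-.
  by apply: contraNneq iD => <-.
rewrite -ltnS (leq_trans _ cxy) // proper_card //; apply/properP; split.
  apply/fintype.subsetP => i; rewrite !inE swapE => /andP[yi].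
  case: tpermP yi => [->|->|_ _ -> ->] //; last by rewrite yb.
  by rewrite (negPf xb).
by exists a; rewrite !inE ?xa ?ya // swapE tpermL (negPf xb) andbF.
Qed.

(* Count the pairs (b, y) with b in D and y containing b; by the symmetry of P
   all b in D contribute equally. *)
Lemma double_count (P : pred V) (D : {set 'I_n}) (j : nat) a :
  (forall b c y, b \in D -> c \in D -> P (swap b c y) = P y) ->
  (forall y, P y -> #|D :&: ones y| = j) -> a \in D ->
  (#|D| * #|[set y | P y & val y a]| = j * #|[set y | P y]|)%N.
Proof.
move=> PD cD aD.
have -> : (#|D| * #|[set y | P y & val y a]| =
    \sum_(b in D) #|[set y | P y & val y b]|)%N.
  rewrite -sum_nat_const; apply: eq_bigr => b bD.
  rewrite -(card_imset _ (inv_inj (swapK a b))); apply: eq_card => y.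
  rewrite -{1}(swapK a b y) (mem_imset _ _ (inv_inj (swapK a b))) !inE.
  by rewrite PD // swapE tpermL.
transitivity (\sum_(b in D) \sum_(y | P y) val y b)%N.
  apply: eq_bigr => b _; rewrite -sum1_card [RHS]big_mkcond [LHS]big_mkcond.
  by apply: eq_bigr => y _; rewrite inE; case: (P y); case: (val y b).
rewrite exchange_big /= mulnC -sum_nat_const; apply: eq_big => [y|y Py].
  by rewrite inE.
rewrite -(cD y Py) -sum1_card [RHS]big_mkcond [LHS]big_mkcond.
by apply: eq_bigr => b _; rewrite !inE; case: (b \in D); case: (val y b).
Qed.

End Johnson.

(** * Proportions of neighbours with prescribed coordinates *)

Section JohnsonCounts.
Variables (n r s : nat).
Hypothesis s_lt_r : (s < r)%N.
Notation V := (johnson_vertex n r).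
Notation G := (johnson n r s).
Notation d := ('C(r, s) * 'C(n - r, r - s))%N.
Implicit Types (x y : V) (a b c : 'I_n).

Lemma johnson_sym : symmetric G.
Proof.
move=> x y; rewrite /johnson /= eq_sym; congr (_ && (_ == _)).
by apply: eq_bigr => i _; rewrite mulnC.
Qed.

Lemma johnson_swap a b x y : G (swap n r a b x) (swap n r a b y) = G x y.
Proof.
rewrite /johnson /= (inj_eq (inv_inj (swapK n r a b))).
by have := inner_prod_swap n r a b x y => /= ->.
Qed.

Lemma johnson_inter x y : G x y -> #|ones n r x :&: ones n r y| = s.
Proof. by case/andP => _ /eqP; rewrite inner_prodE. Qed.

(** Such a swap is an automorphism fixing x, so it permutes the neighbours of x. This is the
    invariance required by [double_count]. *)
Lemma johnson_swap_fix a b x y :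
  val x a = val x b -> G x (swap n r a b y) = G x y.
Proof. by move=> /swap_id xab; rewrite -{1}xab johnson_swap. Qed.

Lemma vertex_lt x a : ~~ val x a -> (r < n)%N.
Proof.
move=> xa; rewrite -(card_ones n r x) -[ltnRHS](card_ord n).
apply: proper_card; apply/properP; split; first exact/fintype.subsetP.
by exists a; rewrite ?inE.
Qed.

Lemma card_nbr x : #|[set y | G x y]| = d.
Proof. exact: johnson_degree. Qed.

(** Double counting over the ones of x, each neighbour having s of them; the next two counts use the
    zeros of x, and the ones of x other than [a]. *)
Lemma card_nbr_in x a : val x a ->
  (r * #|[set y | G x y & val y a]| = s * d)%N.
Proof.
move=> xa; rewrite -{1}(card_ones n r x) -(card_nbr x).
apply: double_count => [b c y||]; last by rewrite inE.
  by rewrite !inE => xb xc; apply: johnson_swap_fix; rewrite xb xc.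
exact: johnson_inter.
Qed.

Lemma card_nbr_out x a : ~~ val x a ->
  ((n - r) * #|[set y | G x y & val y a]| = (r - s) * d)%N.
Proof.
move=> xa.
have nrE : (n - r)%N = #|~: ones n r x|.
  by rewrite cardsCs finset.setCK card_ord card_ones.
rewrite -(card_nbr x) nrE.
apply: double_count => [b c y||]; last by rewrite !inE.
  by rewrite !inE => /negPf xb /negPf xc; apply: johnson_swap_fix; rewrite xb xc.
move=> y /johnson_inter xy; have := cardsID (ones n r x) (ones n r y).
rewrite card_ones finset.setIC xy finset.setDE finset.setIC => /(congr1 (subn^~ s)).
by rewrite addKn.
Qed.

Lemma card_nbr_in2 x a c : val x a -> val x c -> a != c ->
  (r.-1 * #|[set y | G x y && val y a & val y c]| =
   s.-1 * #|[set y | G x y & val y a]|)%N.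
Proof.
move=> xa xc ac.
have ax : a \in ones n r x by rewrite inE.
have -> : r.-1 = #|ones n r x :\ a|.
  by have := cardsD1 a (ones n r x); rewrite ax card_ones => /(congr1 predn).
apply: double_count => [b e y||].
- rewrite !inE => /andP[ba xb] /andP[ea xe].
  rewrite swapE tpermD // johnson_swap_fix //.
  by rewrite xb xe.
- move=> y /andP[/johnson_inter <- ya].
  rewrite [in RHS](cardsD1 a) !inE xa ya /= finset.setIDAC.
  by [].
- by rewrite !inE eq_sym ac.
Qed.

Variable R : realType.

Lemma nbr_in x a : val x a ->
  #|[set y | G x y & val y a]|%:R = s%:R / r%:R * d%:R :> R.
Proof.
move=> xa; have r0 : (r%:R : R) != 0 by rewrite pnatr_eq0 -lt0n (leq_ltn_trans _ s_lt_r).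
by rewrite mulrAC -natrM -(card_nbr_in x a) // natrM mulrC mulKf.
Qed.

Lemma nbr_out x a : ~~ val x a ->
  #|[set y | G x y & val y a]|%:R = (r - s)%:R / (n - r)%:R * d%:R :> R.
Proof.
move=> xa; have r0 : ((n - r)%:R : R) != 0.
  by rewrite pnatr_eq0 subn_eq0 -ltnNge (vertex_lt x a).
by rewrite mulrAC -natrM -(card_nbr_out x a) // natrM mulrC mulKf.
Qed.

Lemma nbr_in2 x a c : val x a -> val x c -> a != c -> (1 < r)%N ->
  #|[set y | G x y && val y a & val y c]|%:R =
    s.-1%:R / r.-1%:R * (s%:R / r%:R) * d%:R :> R.
Proof.
move=> xa xc ac r1.
have r0 : (r.-1%:R : R) != 0 by rewrite pnatr_eq0; case: (r) r1 => [|[]].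
rewrite -mulrA -(nbr_in x a) // mulrAC -natrM -(card_nbr_in2 x a c) //.
by rewrite natrM mulrC mulKf.
Qed.

(** One of [a], [b] is a one of x and the other a zero. A neighbour separating them contains [a] or
    [b], and the two counts add up to the bound. *)
Lemma card_separated x a b : val x a != val x b ->
  #|[set y | G x y & val y a != val y b]|%:R <=
    (s%:R / r%:R + (r - s)%:R / (n - r)%:R) * d%:R :> R.
Proof.
wlog xa : a b / val x a => [hw|].
  case xa: (val x a) => xab; first by apply: hw; rewrite // xa.
  rewrite (_ : [set y | _ & _] = [set y | G x y & val y b != val y a]); last first.
    by apply/setP=> y; rewrite !inE eq_sym.
  by apply: hw; move: xab; case: (val x b); rewrite // xa.
rewrite xa => xb; have {}xb : ~~ val x b by case: (val x b) xb.
rewrite mulrDl -(nbr_in x a xa) -(nbr_out x b xb) -natrD ler_nat.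
apply: leq_trans (leq_card_setU _ _); apply: subset_leq_card.
apply/fintype.subsetP => y; rewrite !inE => /andP[->].
by case: (val y a); case: (val y b).
Qed.

(** Let [a], [c] be the ones of x. A neighbour separating both pairs contains [b], or [e], or both
    [a] and [c]; the last case has the small proportion s(s-1)/(r(r-1)). *)
Lemma card_separated2 x a b c e : (1 < r)%N ->
  a != c -> a != e -> b != c -> b != e ->
  val x a != val x b -> val x c != val x e ->
  #|[set y | [&& G x y, val y a != val y b & val y c != val y e]]|%:R <=
    (s.-1%:R / r.-1%:R * (s%:R / r%:R) + ((r - s)%:R / (n - r)%:R) *+ 2) *
      d%:R :> R.
Proof.
move=> r1.
wlog xa : a b / val x a => [hw|].
  case xa: (val x a) => ac ae bc be xab; first by apply: hw; rewrite // xa.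
  rewrite (_ : [set y | _] =
    [set y | [&& G x y, val y b != val y a & val y c != val y e]]); last first.
    by apply/setP=> y; rewrite !inE (eq_sym (val y a)).
  by apply: hw; move: xab; case: (val x b); rewrite // xa.
wlog xc : c e / val x c => [hw|].
  case xc: (val x c) => ac ae bc be xab xce; first by apply: hw; rewrite // xc.
  rewrite (_ : [set y | _] =
    [set y | [&& G x y, val y a != val y b & val y e != val y c]]); last first.
    by apply/setP=> y; rewrite !inE (eq_sym (val y c)).
  by apply: hw => //; move: xce; case: (val x e); rewrite // xc.
rewrite xa xc => ac ae bc be xb xe.
have {}xb : ~~ val x b by case: (val x b) xb.
have {}xe : ~~ val x e by case: (val x e) xe.
rewrite mulr2n !mulrDl -(nbr_in2 x a c) // -[X in _ + (X + _)](nbr_out x b xb) -(nbr_out x e xe).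
rewrite -!natrD ler_nat addnA.
apply: (@leq_trans #|([set y | G x y && val y a & val y c] :|:
  [set y | G x y & val y b]) :|: [set y | G x y & val y e]|); last first.
  by rewrite (leq_trans (leq_card_setU _ _)) // leq_add2r leq_card_setU.
apply: subset_leq_card.
apply/fintype.subsetP => y; rewrite !inE => /and3P[->].
by case: (val y a); case: (val y b); case: (val y c); case: (val y e).
Qed.

End JohnsonCounts.

(** * Eigenvalues of Johnson graphs *)

(** Only neighbours in the support of [f] enter the eigenvalue equation, so a sparser eigenfunction
    gives a better bound. The maximum point itself lies in the support, which tells which
    coordinates it separates. *)
Lemma eigenfunction_bound (R : realType) (V : finType) (e : rel V) (mu : R)
    (f : V -> R) :
  (exists x, f x != 0) -> eigenfunction R V e mu f ->
  exists2 x, f x != 0 & `|mu| <= #|[set y | e x y & f y != 0]|%:R.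
Proof.
case=> x0 fx0 fmu.
have [x _ xmax] := @arg_maxP _ R V x0 predT (fun x => `|f x|) isT.
have fx : 0 < `|f x| by rewrite (lt_le_trans _ (xmax x0 isT)) ?normr_gt0.
exists x; first by rewrite -normr_gt0.
rewrite -(ler_pM2r fx) -normrM -fmu (le_trans (ler_norm_sum _ _ _)) //.
rewrite mulr_natl -sumr_const (bigID (fun y => f y != 0)) /=.
rewrite [X in _ + X]big1 ?addr0; last by move=> y /andP[_ /negPn/eqP ->]; rewrite normr0.
rewrite [leRHS](eq_bigl (fun y => e x y && (f y != 0))); last by move=> y; rewrite inE.
by apply: ler_sum => y _; exact: xmax.
Qed.

Section JohnsonEigenvalues.
Variables (R : realType) (n r s : nat).
Hypothesis s_lt_r : (s < r)%N.
Notation V := (johnson_vertex n r).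
Notation G := (johnson n r s).
Notation d := ('C(r, s) * 'C(n - r, r - s))%N.
Notation eigen := (eigenfunction R V G).
Notation sw := (swap n r).
Notation theta := ((s%:R / r%:R - (r - s)%:R / (n - r)%:R) * d%:R : R).
Implicit Types (x y : V) (a b c : 'I_n) (f g : V -> R).

Definition coord_diff a b x : R := (val x a)%:R - (val x b)%:R.

Lemma sum_coord_diff a b : \sum_x coord_diff a b x = 0.
Proof.
rewrite sumrB; apply/eqP; rewrite subr_eq0; apply/eqP.
rewrite (reindex_inj (inv_inj (swapK n r a b))) /=.
by apply: eq_bigr => x _; have := swapE n r a b x a => /= ->; rewrite tpermL.
Qed.

Lemma sum_nbr_coord x a :
  \sum_(y | G x y) (val y a)%:R = #|[set y | G x y & val y a]|%:R :> R.
Proof.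
rewrite -sum1_card natr_sum [LHS]big_mkcond [RHS]big_mkcond.
by apply: eq_bigr => y _; rewrite inE; case: (G x y); case: (val y a).
Qed.

(** The number of neighbours containing [a] takes one value when x contains [a] and another when it
    does not; [theta] is the difference of the two. *)
Lemma coord_diff_eigen a b : eigen theta (coord_diff a b).
Proof.
move=> x; rewrite sumrB !sum_nbr_coord /coord_diff.
case: (boolP (val x a)) => xa; case: (boolP (val x b)) => xb.
- by rewrite !nbr_in // !subrr mulr0.
- by rewrite nbr_in // nbr_out // subr0 mulr1 mulrBl.
- by rewrite nbr_out // nbr_in // sub0r mulrN1 -[RHS]mulNr opprB mulrBl.
- by rewrite !nbr_out // !subrr mulr0.
Qed.

Lemma vertex_exists : (r <= n)%N -> exists x : V, true.
Proof.
move=> rn; have : (0 < #|[set A : {set 'I_n} | A \subset [set: 'I_n] & #|A| == r]|)%N.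
  by rewrite cards_draws cardsT card_ord bin_gt0.
by case/card_gt0P => A; rewrite !inE => /andP[_ /eqP/ones_surj[x _]]; exists x.
Qed.

Lemma coord_diff_neq0 : (0 < r < n)%N -> exists a b x, coord_diff a b x != 0.
Proof.
move=> /andP[r0 rn]; have [x _] := vertex_exists (ltnW rn).
have /card_gt0P[a] : (0 < #|ones n r x|)%N by rewrite card_ones.
have /card_gt0P[b] : (0 < #|~: ones n r x|)%N.
  by rewrite cardsCs finset.setCK card_ord card_ones subn_gt0.
rewrite !inE => /negPf xb xa; exists a, b, x.
by rewrite /coord_diff xa xb subr0 oner_neq0.
Qed.

(** A swap is a graph automorphism, so composing with it preserves eigenspaces. *)
Lemma eigen_sub_swap mu f a b : eigen mu f ->
  eigen mu (fun x => f x - f (sw a b x)).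
Proof.
move=> fmu x; rewrite sumrB mulrBr fmu; congr (_ - _).
rewrite -fmu (reindex_inj (inv_inj (swapK n r a b))) /=.
by apply: eq_big => y; [rewrite -(johnson_swap _ _ _ a b) !swapK | rewrite swapK].
Qed.

(** A vertex agreeing at [a] and [b] is fixed by the swap, which forces g x = - g x. *)
Lemma antisymmetric_eq0 g a b x :
  (forall y, g (sw a b y) = - g y) -> g x != 0 -> val x a != val x b.
Proof.
move=> ganti; apply: contraNneq => xab; have := ganti x; rewrite swap_id // => gx.
by apply/eqP; lra.
Qed.

Lemma antisymmetrize mu f : (exists x, f x != 0) -> eigen mu f ->
  \sum_x f x = 0 ->
  exists a b (g : V -> R), [/\ exists x, g x != 0, eigen mu g &
    forall y, g (sw a b y) = - g y].
Proof.
move=> [x0 fx0] fmu f1.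
case: (pselect (exists a b x, f x != f (sw a b x))) => [[a [b [x fx]]]|nf].
  exists a, b, (fun x => f x - f (sw a b x)); split.
  - by exists x; rewrite subr_eq0.
  - exact: eigen_sub_swap.
  - by move=> y; rewrite swapK opprB.
(* If no swap moves [f], transitivity makes it constant, and a nonzero constant has nonzero sum over
   the nonempty vertex set. *)
have fc y : f y = f x0.
  apply: (@swap_invariant n r R [set: 'I_n] f) => [a b x _ _|i]; last by rewrite inE.
  by apply/esym/eqP; apply: contrapT => /negP h; apply: nf; exists a, b, x.
move: f1; under eq_bigr do rewrite fc.
rewrite sumr_const => /eqP; rewrite mulrn_eq0 (negPf fx0) orbF => /eqP.
by move/card0_eq/(_ x0).
Qed.

Lemma eigenvalue_le mu f : (exists x, f x != 0) -> eigen mu f ->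
  \sum_x f x = 0 ->
  `|mu| <= (s%:R / r%:R + (r - s)%:R / (n - r)%:R) * d%:R.
Proof.
move=> f0 fmu f1; have [a [b [g [g0 gmu ganti]]]] := antisymmetrize mu f f0 fmu f1.
have [x gx le_mu] := eigenfunction_bound _ _ _ _ _ g0 gmu.
apply: le_trans le_mu (le_trans _ (card_separated _ _ _ s_lt_r R x a b _)).
  rewrite ler_nat; apply: subset_leq_card; apply/fintype.subsetP => y.
  by rewrite !inE => /andP[->] /(antisymmetric_eq0 g a b y ganti).
exact: (antisymmetric_eq0 g).
Qed.

Lemma eigenvalue_theta_or_le mu f : (1 < r)%N ->
  (exists x, f x != 0) -> eigen mu f -> \sum_x f x = 0 ->
  mu = theta \/
  `|mu| <= (s.-1%:R / r.-1%:R * (s%:R / r%:R) +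
              ((r - s)%:R / (n - r)%:R) *+ 2) * d%:R.
Proof.
move=> r1 f0 fmu f1; have [a [b [g [g0 gmu ganti]]]] := antisymmetrize mu f f0 fmu f1.
(* The dichotomy: either some swap of coordinates off a and b moves [g], or [g] is invariant under
   all of them. *)
case: (pselect (exists c e x, [/\ c \notin [set a; b], e \notin [set a; b] & g x != g (sw c e x)])).
  case=> c [e [x [cD eD gx]]]; right.
  have [ac [ae [bc be]]] : a != c /\ a != e /\ b != c /\ b != e.
    by move: cD eD; rewrite !inE !negb_or !(eq_sym c) !(eq_sym e) =>
      /andP[-> ->] /andP[-> ->].
  pose h x := g x - g (sw c e x).
  have hmu : eigen mu h by exact: eigen_sub_swap.
  have hce y : h (sw c e y) = - h y by rewrite /h swapK opprB.
  (* Disjoint swaps commute, so the second antisymmetrization keeps the first one. *)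
  have hab y : h (sw a b y) = - h y.
    by rewrite /h -swap_comm // !ganti opprB opprK addrC.
  have h0 : exists x, h x != 0 by exists x; rewrite subr_eq0.
  have [z hz le_mu] := eigenfunction_bound _ _ _ _ _ h0 hmu.
  apply: le_trans le_mu
    (le_trans _ (card_separated2 _ _ _ s_lt_r R z a b c e r1 ac ae bc be _ _)).
  - rewrite ler_nat; apply: subset_leq_card; apply/fintype.subsetP => y.
    rewrite !inE => /andP[-> hy] /=.
    by rewrite (antisymmetric_eq0 h a b y) // (antisymmetric_eq0 h c e y).
  - exact: (antisymmetric_eq0 h).
  - exact: (antisymmetric_eq0 h).
move=> ng; left; case: g0 => x.
wlog xa : a b ganti ng / val x a => [hw|gx].
  case xa: (val x a) => gx; first exact: (hw a b).
  have := antisymmetric_eq0 g a b x ganti gx; rewrite xa => xb.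
  apply: (hw b a) => //; last by case: (val x b) xb.
    by move=> y; rewrite swapC.
  move=> [c [e [z [cD eD gz]]]]; apply: ng; exists c, e, z; split=> //.
    by move: cD; rewrite !inE orbC.
  by move: eD; rewrite !inE orbC.
have xb : ~~ val x b.
  by have := antisymmetric_eq0 g a b x ganti gx; rewrite xa; case: (val x b).
(* Invariance under swaps off a and b means that [g] depends only on the two coordinates a and b.
   Antisymmetry then makes it a multiple of [coord_diff a b]. *)
have gE y : val y a -> ~~ val y b -> g y = g x.
  move=> ya yb; apply: (@swap_invariant n r R (~: [set a; b]) g) => [c e z|i].
    rewrite !inE => cD eD; apply/esym/eqP; apply: contrapT => /negP h; apply: ng.
    by exists c, e, z; rewrite !inE.
  by rewrite !inE negbK => /orP[] /eqP ->; rewrite ?xa ?ya // (negPf xb) (negPf yb).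
have gdiff y : g y = g x * coord_diff a b y.
  rewrite /coord_diff; case: (boolP (val y a)) => ya; case: (boolP (val y b)) => yb.
  - by rewrite subrr mulr0; apply/eqP; apply: contraT =>
      /(antisymmetric_eq0 g a b y ganti); rewrite ya yb.
  - by rewrite subr0 mulr1 gE.
  - rewrite sub0r mulrN1 -[LHS]opprK -ganti gE // swapE ?tpermL ?tpermR //.
  - by rewrite subrr mulr0; apply/eqP; apply: contraT =>
      /(antisymmetric_eq0 g a b y ganti); rewrite (negPf ya) (negPf yb).
apply: (mulIf gx); rewrite -gmu; under eq_bigr do rewrite gdiff.
rewrite -big_distrr /= coord_diff_eigen mulrCA; congr (_ * _).
by rewrite -gdiff.
Qed.

End JohnsonEigenvalues.

Lemma regular_degreeE (n r s : nat) : (s < r)%N -> (r <= n)%N ->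
  regular_degree (johnson n r s) = ('C(r, s) * 'C(n - r, r - s))%N.
Proof.
move=> sr rn; rewrite /regular_degree; case: pickP => [x _|V0].
  exact: johnson_degree.
by have [x _] := vertex_exists n r rn; have := V0 x.
Qed.

(** * The value of E_k(1) and its ratio to the degree *)

Lemma binz_nat (a b : nat) : binz a b = 'C(a, b).
Proof. by rewrite /binz lez_nat /=; case: leqP => // ab; rewrite bin_small. Qed.

Lemma Ek1E (n r k : nat) : (0 < k)%N -> (0 < r < n)%N ->
  Ek n r k 1 = 'C(r.-1, k)%:Z * 'C((n - r).-1, k)%:Z -
               'C(r.-1, k.-1)%:Z * 'C((n - r).-1, k.-1)%:Z.
Proof.
case: k => // k _ /andP[r0 rn].
have r1 : r%:Z - 1%:Z = r.-1 by lia.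
have n1 : n%:Z - r%:Z - 1%:Z = (n - r).-1 by lia.
have k1 : k.+1%:Z - (1%N)%:Z = k by lia.
(* Only j = 0 and j = 1 survive, because the binomial of 1 over j vanishes from j = 2 on; both
   indices occur as k is positive. *)
rewrite /Ek 2!big_ord_recl big1 => [|i _]; last first.
  by rewrite (_ : binz 1 _ = 0%N) ?mulr0 ?mul0r.
rewrite r1 n1 /= /bump /= addr0 expr0 expr1 subr0 k1 !binz_nat.
by rewrite !bin0 !bin1 !mul1r mulr1 !mulN1r mulNr.
Qed.

(** With k = r - s and m = n - r, the binomials with lower index k - 1 are the fractions q = k/r and
    p = k/m of C(r,k) and C(m,k). So the ratio is (1-q)(1-p) - qp = 1 - q - p, where 1 - q = s/r. *)
Lemma Ek1_ratio (R : realType) (n r s : nat) : (s < r)%N -> (r < n)%N ->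
  (Ek n r (r - s) 1)%:~R = (s%:R / r%:R - (r - s)%:R / (n - r)%:R) *
    ('C(r, s) * 'C(n - r, r - s))%:R :> R.
Proof.
move=> sr rn; have k0 : (0 < r - s)%N by rewrite subn_gt0.
have sE : s = (r - (r - s))%N by rewrite subKn // ltnW.
rewrite Ek1E // ?rn ?(leq_ltn_trans _ sr) //.
have kr : (r - s <= r)%N by rewrite leq_subr.
rewrite -(bin_sub (ltnW sr)) rmorphB !rmorphM /=.
have -> : s%:R = r%:R - (r - s)%:R :> R by rewrite {1}sE natrB.
move: k0 kr; set k := (r - s)%N; set m := (n - r)%N.
have : (0 < m)%N by rewrite subn_gt0.
have : (0 < r)%N by exact: leq_ltn_trans sr.
clearbody k m; clear; case: r => // r _; case: m => // m _; case: k => // k _ _ /=.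
have := mul_bin_diag r.+1 k; have := mul_bin_diag m.+1 k.
rewrite !binS /= -!pmulrn !natrD.
(* Here [r] and [m] stand for the original values minus one; by Pascal's rule the full binomials are
   A + B and C + D. *)
move: 'C(r, k.+1) 'C(r, k) 'C(m, k.+1) 'C(m, k) => A B C D hm hr.
have {}hm : D%:R = k.+1%:R / m.+1%:R * (C%:R + D%:R) :> R.
  by rewrite mulrAC -natrD -natrM -hm natrM mulrAC mulfV ?mul1r ?pnatr_eq0.
have {}hr : B%:R = k.+1%:R / r.+1%:R * (A%:R + B%:R) :> R.
  by rewrite mulrAC -natrD -natrM -hr natrM mulrAC mulfV ?mul1r ?pnatr_eq0.
have r0 : (r.+1%:R : R) != 0 by rewrite pnatr_eq0.
rewrite [(_ - _) / _]mulrBl mulfV //.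
move: (k.+1%:R / m.+1%:R) (k.+1%:R / r.+1%:R) hm hr => p q hm hr.
have -> : (1 - q - p) * ((A%:R + B%:R) * (C%:R + D%:R)) =
   (A%:R + B%:R) * (C%:R + D%:R) - (q * (A%:R + B%:R)) * (C%:R + D%:R) -
   (A%:R + B%:R) * (p * (C%:R + D%:R)) :> R by ring.
by rewrite -hm -hr; ring.
Qed.

(** * Two-sided bounds and the exact value of lambda *)

Section JohnsonLambda.
Variables (R : realType) (n r s : nat).
Hypotheses (s_lt_r : (s < r)%N) (r_lt_n : (r < n)%N).
Notation d := ('C(r, s) * 'C(n - r, r - s))%N.
Notation lam := (graph_lambda R (johnson n r s)).

Lemma vertices_gt0 : (0 < #|johnson_vertex n r|)%N.
Proof.
by have [x _] := vertex_exists n r (ltnW r_lt_n); apply/card_gt0P; exists x.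
Qed.

Lemma johnson_lambda_le :
  lam <= (s%:R / r%:R + (r - s)%:R / (n - r)%:R) * d%:R.
Proof.
apply: (graph_lambda_le _ _ _ d (johnson_sym n r s)) => //.
- by move=> x; exact: johnson_degree.
- exact: vertices_gt0.
- by move=> mu f; exact: eigenvalue_le.
Qed.

Lemma johnson_lambda_ge :
  (s%:R / r%:R - (r - s)%:R / (n - r)%:R) * d%:R <= lam.
Proof.
have r0 : (0 < r)%N by exact: leq_ltn_trans s_lt_r.
have [|a [b ab]] := @coord_diff_neq0 R n r; first by rewrite r0.
apply: (graph_lambda_ge _ _ _ d (johnson_sym n r s) _ _ (coord_diff R n r a b)) => //.
- by move=> x; exact: johnson_degree.
- exact: coord_diff_eigen.
- exact: sum_coord_diff.
- rewrite ler_piMl // lerBlDr (@le_trans _ _ 1) ?lerDl ?divr_ge0 //.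
  by rewrite ler_pdivrMr ?ltr0n // mul1r ler_nat ltnW.
Qed.

Lemma johnson_lambda_dist :
  `|lam - s%:R / r%:R * d%:R| <= (r - s)%:R / (n - r)%:R * d%:R.
Proof.
have := johnson_lambda_le; have := johnson_lambda_ge.
by move=> h1 h2; rewrite ler_norml; apply/andP; split; lra.
Qed.

Lemma johnson_lambda_eq : (0 < s)%N -> (4 * r ^ 2 <= n)%N ->
  lam = (Ek n r (r - s) 1)%:~R.
Proof.
move=> s0 rn; rewrite Ek1_ratio //; apply/le_anti/andP; split; last exact: johnson_lambda_ge.
have r1 : (1 < r)%N by lia.
(* The two sides differ by (r-s)(s/(r(r-1)) - 3/(n-r)), which is nonnegative once 3r(r-1) <= s(n-r);
   this follows from s >= 1 and n >= 4r^2. *)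
have key : s.-1%:R / r.-1%:R * (s%:R / r%:R) + ((r - s)%:R / (n - r)%:R) *+ 2
   <= s%:R / r%:R - (r - s)%:R / (n - r)%:R :> R.
  have rs : (1 <= s < r)%N by rewrite s0.
  have s1E : s.-1%:R = s%:R - 1 :> R by rewrite -[in RHS](prednK s0) -natr1 addrK.
  have r1E : r.-1%:R = r%:R - 1 :> R by rewrite -[in RHS](prednK (ltnW r1)) -natr1 addrK.
  have rp : 0 < r%:R :> R by rewrite ltr0n; lia.
  have r1p : 0 < r%:R - 1 :> R by rewrite subr_gt0 ltr1n.
  have np : 0 < (n - r)%:R :> R by rewrite ltr0n subn_gt0.
  rewrite -subr_ge0 s1E r1E.
  have -> : s%:R / r%:R - (r - s)%:R / (n - r)%:R -
      ((s%:R - 1) / (r%:R - 1) * (s%:R / r%:R) + (r - s)%:R / (n - r)%:R *+ 2) =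
      (r - s)%:R * (s%:R / (r%:R * (r%:R - 1)) - 3%:R / (n - r)%:R) :> R.
    rewrite [(r - s)%:R]natrB; last exact: ltnW.
    by field; rewrite ?gt_eqF.
  rewrite mulr_ge0 // subr_ge0 ler_pdivrMr // mulrAC ler_pdivlMr ?mulr_gt0 //.
  rewrite -r1E -!natrM ler_nat.
  by move: rn rs; rewrite -mulnn; nia.
(* By [key], theta dominates a sum of nonnegative terms; hence it equals its absolute value, as the
   upper bound on all |mu| requires. *)
have theta0 : 0 <= (s%:R / r%:R - (r - s)%:R / (n - r)%:R) * d%:R :> R.
  apply: mulr_ge0 => //; apply: le_trans key.
  by apply: addr_ge0; rewrite ?mulrn_wge0 ?mulr_ge0 ?divr_ge0.
apply: (graph_lambda_le _ _ _ d (johnson_sym n r s)) => //.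
- by move=> x; exact: johnson_degree.
- exact: vertices_gt0.
- move=> mu f f0 fmu f1.
  have [->|le_mu] := eigenvalue_theta_or_le R n r s s_lt_r mu f r1 f0 fmu f1.
    by rewrite ger0_norm.
  by rewrite (le_trans le_mu) // ler_wpM2r.
Qed.

End JohnsonLambda.

(** * Asymptotics *)

Local Open Scope classical_set_scope.
Local Open Scope ring_scope.

Lemma dominates_near (R : realType) (f g : nat -> nat) (M : R) :
  dominates R f g ->
  \forall n \near \oo, (0 < f n)%N /\ M * (g n)%:R <= (f n)%:R.
Proof.
(* The threshold is kept at least 1 so that a quotient 0/0, which evaluates to 0, is excluded and
   [f n] must be positive. *)
move=> /cvgeyPge/(_ (Num.max M 1)); apply: filterS => n.
have M1 : M <= Num.max M 1 by rewrite le_max lexx.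
have M2 : 0 < Num.max M 1 :> R by rewrite lt_max ltr01 orbT.
rewrite inver; case: ifP => [/eqP g0|/negbT g0].
  move=> h; rewrite g0 mulr0; split=> //; rewrite lt0n; apply/eqP => f0.
  by move: h; rewrite f0 mul0e lee_fin leNgt M2.
move=> h; have {h} h : Num.max M 1 * (g n)%:R <= (f n)%:R.
  have gp : 0 < (g n)%:R :> R by rewrite lt_neqAle eq_sym g0 ler0n.
  by rewrite -ler_pdivlMr // -lee_fin EFinM.
split; last by rewrite (le_trans _ h) // ler_wpM2r.
rewrite -(ltr0n R) (lt_le_trans _ h) // mulr_gt0 //.
by rewrite lt_neqAle eq_sym g0 ler0n.
Qed.

(** Since n <= 2(n-r), the left side is at most 2r/n, and 2r/n <= eps s/r is the last hypothesis
    rearranged. *)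
Lemma ratio_le (R : realType) (n r s : nat) (eps : R) :
  (s < r)%N -> (2 * r <= n)%N -> 0 <= eps ->
  2 * r%:R ^+ 2 <= eps * s%:R * n%:R ->
  (r - s)%:R / (n - r)%:R <= eps * (s%:R / r%:R).
Proof.
move=> sr rn e0 h.
have r0 : (0 < r)%N by exact: leq_ltn_trans sr.
have rp : 0 < r%:R :> R by rewrite ltr0n.
have np : 0 < (n - r)%:R :> R by rewrite ltr0n subn_gt0; lia.
have rsR : (r - s)%:R <= r%:R :> R by rewrite ler_nat leq_subr.
have nR : n%:R <= 2 * (n - r)%:R :> R by rewrite -natrM ler_nat; lia.
rewrite mulrA ler_pdivrMr // mulrAC ler_pdivlMr //.
have h1 : (r - s)%:R * r%:R <= r%:R ^+ 2 :> R by rewrite expr2 ler_wpM2r.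
have h2 : eps * s%:R * n%:R <= eps * s%:R * (2 * (n - r)%:R).
  by rewrite ler_wpM2l // mulr_ge0.
lra.
Qed.

(** Reduces a relative error [eps] to the single inequality 2r^2 <= eps s n, to be checked in each
    regime. *)
Lemma johnson_lambda_near (R : realType) (n r s : nat) (eps : R) :
  (s < r)%N -> (2 * r <= n)%N -> 0 <= eps ->
  2 * r%:R ^+ 2 <= eps * s%:R * n%:R ->
  `|graph_lambda R (johnson n r s) -
      s%:R / r%:R * (regular_degree (johnson n r s))%:R| <=
    eps * `|s%:R / r%:R * (regular_degree (johnson n r s))%:R|.
Proof.
move=> sr rn e0 h; have rltn : (r < n)%N by lia.
rewrite regular_degreeE ?(ltnW rltn) //.
apply: le_trans (johnson_lambda_dist R n r s sr rltn) _.
rewrite [`|_|]ger0_norm ?mulr_ge0 ?divr_ge0 //.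
by rewrite [leRHS]mulrA ler_wpM2r // ratio_le.
Qed.

Lemma equiv_near (R : realType) (u v : nat -> R) :
  (forall eps, 0 < eps -> \forall n \near \oo, `|u n - v n| <= eps * `|v n|) ->
  u ~_\oo v.
Proof. by move=> h; apply/eqaddoP => eps e0; exact: h. Qed.

Lemma bigO_sqrt_near (R : realType) (r : nat -> nat) :
  (fun n => (r n)%:R : R) =O_\oo (fun n : nat => Num.sqrt (n%:R : R)) ->
  exists2 C : R, 0 < C & \forall n \near \oo,
    (2 * r n <= n)%N /\ (r n)%:R ^+ 2 <= C * n%:R.
Proof.
move=> /eqO_exP[C C0 rC]; exists (C ^+ 2); first by rewrite exprn_gt0.
near=> n.
have rn : (r n)%:R <= C * Num.sqrt n%:R.
  by have := near rC n; rewrite !ger0_norm ?sqrtr_ge0 //; apply.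
have r2 : (r n)%:R ^+ 2 <= C ^+ 2 * n%:R.
  have n0 : 0 <= n%:R :> R by [].
  have h0 : 0 <= C * Num.sqrt n%:R by rewrite mulr_ge0 ?sqrtr_ge0 // ltW.
  rewrite -[X in _ * X](sqr_sqrtr n0) -exprMn.
  by apply: lerXn2r; rewrite ?nnegrE.
split=> //.
(* Then 4r^2 <= 4C^2 n <= n^2, that is 2r <= n. *)
have nC : 4 * C ^+ 2 <= n%:R by near: n; exact: nbhs_infty_ger.
rewrite -(ler_nat R) natrM -(@ler_pXn2r _ 2) ?nnegrE ?mulr_ge0 //.
have : 4 * C ^+ 2 * n%:R <= n%:R * n%:R :> R by rewrite ler_wpM2r.
by rewrite exprMn; lra.
Unshelve. all: by end_near. Qed.

(** * The three regimes *)

Lemma johnson_lambda_fixed (R : realType) (r s : nat) : (s < r)%N -> (1 <= s)%N ->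
     (exists N : nat, forall n : nat, (N < n)%N ->
        graph_lambda R (johnson n r s) = (Ek n r (r - s) 1)%:~R) /\
     (fun n : nat => (Ek n r (r - s) 1)%:~R : R) ~_\oo
       (fun n : nat => s%:R / r%:R * (regular_degree (johnson n r s))%:R : R).
Proof.
move=> sr s1; split.
  exists (4 * r ^ 2)%N => n nr; apply: johnson_lambda_eq => //; last exact: ltnW.
  by move: nr; rewrite -mulnn; nia.
apply: equiv_near => eps e0; near=> n.
have rn : (4 * r ^ 2 <= n)%N by near: n; exact: nbhs_infty_ge.
have rn' : (r < n)%N by move: rn; rewrite -mulnn; nia.
(* For such n, E_{r-s}(1) is lambda itself, so its equivalent comes from the estimate on lambda. *)
rewrite -johnson_lambda_eq //; apply: johnson_lambda_near (ltW e0) _ => //.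
  by move: rn; rewrite -mulnn; nia.
have h : 2 * r%:R ^+ 2 / eps <= n%:R by near: n; exact: nbhs_infty_ger.
rewrite -mulrA [leRHS]mulrC -ler_pdivrMr // (le_trans h) // ler_peMl //.
by rewrite ler1n.
Unshelve. all: by end_near. Qed.

Lemma johnson_lambda_littleo (R : realType) (r s : nat -> nat) :
     dominates R (fun n : nat => n) r -> dominates R r s ->
     (fun n : nat => graph_lambda R (johnson n (r n) (s n))) =o_\oo
       (fun n : nat => (regular_degree (johnson n (r n) (s n)))%:R : R).
Proof.
move=> nr rs; apply/eqoP => eps e0; near=> n.
(* In the constant 2 + 2/eps, the 2 yields s < r < n and absorbs the r subtracted in n - r; the
   2/eps makes each of s/r and (r-s)/(n-r) at most eps/2. *)
have [n0 nr1] : (0 < n)%N /\ (2 + 2 / eps) * (r n)%:R <= n%:R.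
  by near: n; exact: (dominates_near R (fun n => n) r).
have [r0 rs1] : (0 < r n)%N /\ (2 + 2 / eps) * (s n)%:R <= (r n)%:R.
  by near: n; exact: (dominates_near R r s).
have e1 : 0 < 2 / eps by rewrite divr_gt0.
have double_lt a b : (0 < b)%N -> (2 + 2 / eps) * a%:R <= b%:R :> R -> (a < b)%N.
  move=> b0 ab; rewrite ltnNge; apply/negP => ba.
  have bR : 0 < b%:R :> R by rewrite ltr0n.
  have aR : b%:R <= a%:R :> R by rewrite ler_nat.
  have : 0 <= 2 / eps * a%:R by rewrite mulr_ge0 // ltW.
  lra.
have sr := double_lt _ _ r0 rs1; have rn := double_lt _ _ n0 nr1.
have rp : 0 < (r n)%:R :> R by rewrite ltr0n.
have nrp : 0 < (n - r n)%:R :> R by rewrite ltr0n subn_gt0.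
have h1 : (s n)%:R / (r n)%:R <= eps / 2.
  rewrite ler_pdivrMr // -ler_pdivrMl ?divr_gt0 // invf_div.
  by have : 0 <= (s n)%:R :> R by []; lra.
have h2 : (r n - s n)%:R / (n - r n)%:R <= eps / 2.
  rewrite ler_pdivrMr // -ler_pdivrMl ?divr_gt0 // invf_div [(n - r n)%:R]natrB; last exact: ltnW.
  have : 2 / eps * (r n - s n)%:R <= 2 / eps * (r n)%:R.
    by rewrite ler_wpM2l ?(ltW e1) // ler_nat leq_subr.
  by lra.
rewrite regular_degreeE ?(ltnW rn) //.
have := johnson_lambda_dist R n (r n) (s n) sr rn.
rewrite [`|_%:R|]ger0_norm //.
have := ler0n R ('C(r n, s n) * 'C(n - r n, r n - s n)).
move: (_ * _)%:R => D D0.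
have := ler_wpM2r D0 h1; have := ler_wpM2r D0 h2.
have : 0 <= (s n)%:R / (r n)%:R * D by rewrite mulr_ge0 // divr_ge0.
by rewrite !ler_norml => ? ? ? /andP[? ?]; apply/andP; split; lra.
Unshelve. all: by end_near. Qed.

Lemma johnson_lambda_sqrt (R : realType) (r s : nat -> nat) :
     (fun n : nat => (r n)%:R : R) =O_\oo
       (fun n : nat => Num.sqrt (n%:R : R)) ->
     dominates R r s -> (forall n : nat, (1 <= s n)%N) ->
     (fun n : nat => graph_lambda R (johnson n (r n) (s n))) =O_\oo
       (fun n : nat => (s n)%:R / (r n)%:R *
                       (regular_degree (johnson n (r n) (s n)))%:R : R)
     /\
     (s n @[n --> \oo] --> \oo \/
      (fun n : nat => (r n)%:R : R) =o_\oo
        (fun n : nat => Num.sqrt (n%:R : R)) ->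
      (fun n : nat => graph_lambda R (johnson n (r n) (s n))) ~_\oo
        (fun n : nat => (s n)%:R / (r n)%:R *
                        (regular_degree (johnson n (r n) (s n)))%:R : R)).
Proof.
move=> /bigO_sqrt_near[C C0 rC] rs s1.
have sr : \forall n \near \oo, (s n < r n)%N.
  near=> n.
  have [r0] : (0 < r n)%N /\ 2 * (s n)%:R <= (r n)%:R :> R.
    by near: n; exact: dominates_near.
  by rewrite -natrM ler_nat; have := s1 n; lia.
split.
  (* From r^2 <= C n and s >= 1 the relative error is at most 2C; the extra 1 accounts for the main
     term. *)
  apply/eqO_exP; exists (2 * C + 1); first by rewrite addr_gt0 // mulr_gt0.
  near=> n.
  have [rn r2] : (2 * r n <= n)%N /\ (r n)%:R ^+ 2 <= C * n%:R by near: n.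
  have srn : (s n < r n)%N by near: n.
  have C2 : 0 <= 2 * C by rewrite mulr_ge0 // ltW.
  have h : 2 * (r n)%:R ^+ 2 <= 2 * C * (s n)%:R * n%:R.
    have : C * n%:R <= C * n%:R * (s n)%:R by rewrite ler_peMr ?ler1n // mulr_ge0 // ltW.
    lra.
  have := johnson_lambda_near R n (r n) (s n) (2 * C) srn rn C2 h.
  move=> near_v; rewrite mulrDl mul1r -lerBlDr
    (le_trans (lerB_dist _ _)) //.
move=> h; apply: equiv_near => eps e0.
(* Either condition gives the inequality: under (a), s eventually exceeds 2C/eps, which offsets the
   constant in r^2 <= C n; under (b), r^2 <= (eps/2) n eventually and s >= 1. *)
have {}h : \forall n \near \oo, 2 * (r n)%:R ^+ 2 <= eps * (s n)%:R * n%:R.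
  case: h => [/cvgnyPge soo|/eqoP ro].
    near=> n.
    have [_ r2] : (2 * r n <= n)%N /\ (r n)%:R ^+ 2 <= C * n%:R by near: n.
    have sn : 2 * C / eps <= (s n)%:R.
      near: n; apply: filterS (soo (Num.bound (2 * C / eps))) => n sn.
      have x0 : 0 <= 2 * C / eps by rewrite divr_ge0 ?mulr_ge0 // ltW.
      by rewrite (le_trans (ltW (archi_boundP x0))) // ler_nat.
    have : 2 * C * n%:R <= (s n)%:R * eps * n%:R by rewrite ler_wpM2r // -ler_pdivrMr.
    lra.
  have q0 : 0 < Num.sqrt (eps / 2) by rewrite sqrtr_gt0 divr_gt0.
  near=> n.
  have rn : (r n)%:R <= Num.sqrt (eps / 2) * Num.sqrt n%:R.
    by have := near (ro _ q0) n; rewrite !ger0_norm ?sqrtr_ge0 //; apply.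
  have r2 : (r n)%:R ^+ 2 <= eps / 2 * n%:R.
    have n0 : 0 <= n%:R :> R by [].
    have e2 : 0 <= eps / 2 by rewrite divr_ge0 // ltW.
    rewrite -(sqr_sqrtr n0) -[X in X * _](sqr_sqrtr e2) -exprMn.
    by apply: lerXn2r; rewrite ?nnegrE ?mulr_ge0 ?sqrtr_ge0.
  have : eps * n%:R <= eps * n%:R * (s n)%:R by rewrite ler_peMr ?ler1n // mulr_ge0 // ltW.
  lra.
near=> n; apply: johnson_lambda_near (ltW e0) _; near: n => //.
by apply: filterS rC => n [].
Unshelve. all: by end_near. Qed.

Theorem theorem2p2 (R : realType) :
  (forall r s : nat, (s < r)%N -> (1 <= s)%N ->
     (exists N : nat, forall n : nat, (N < n)%N ->
        graph_lambda R (johnson n r s) = (Ek n r (r - s) 1)%:~R) /\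
     (fun n : nat => (Ek n r (r - s) 1)%:~R : R) ~_\oo
       (fun n : nat => s%:R / r%:R * (regular_degree (johnson n r s))%:R : R))
  /\
  (forall r s : nat -> nat,
     dominates R (fun n : nat => n) r -> dominates R r s ->
     dominates R (fun n : nat => (r n ^ 2)%N) (fun n : nat => n) ->
     (fun n : nat => graph_lambda R (johnson n (r n) (s n))) =o_\oo
       (fun n : nat => (regular_degree (johnson n (r n) (s n)))%:R : R))
  /\
  (forall r s : nat -> nat,
     (fun n : nat => (r n)%:R : R) =O_\oo
       (fun n : nat => Num.sqrt (n%:R : R)) ->
     dominates R r s -> (forall n : nat, (1 <= s n)%N) ->
     (fun n : nat => graph_lambda R (johnson n (r n) (s n))) =O_\oo
       (fun n : nat => (s n)%:R / (r n)%:R *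
                       (regular_degree (johnson n (r n) (s n)))%:R : R)
     /\
     (s n @[n --> \oo] --> \oo \/
      (fun n : nat => (r n)%:R : R) =o_\oo
        (fun n : nat => Num.sqrt (n%:R : R)) ->
      (fun n : nat => graph_lambda R (johnson n (r n) (s n))) ~_\oo
        (fun n : nat => (s n)%:R / (r n)%:R *
                        (regular_degree (johnson n (r n) (s n)))%:R : R))).
Proof.
split; first exact: johnson_lambda_fixed.
split; last exact: johnson_lambda_sqrt.
by move=> r s nr rs _; exact: johnson_lambda_littleo.
Qed.
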